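(* Let $A=[a_{ij}]_{i,j=1}^N\in\mathbb{C}^{M\times M}$ be a complex matrix in block form, with $a_{ij}\in\mathbb{C}^{m_i\times m_j}$, $m_i\in\{1,\ldots,M-1\}$, $\sum_{i=1}^N m_i=M$ and $M\ge N>1$. Then, for $n=1,\ldots,N-1$ and $\varepsilon\ge0$, $$\mathrm{Spec}_\varepsilon A\subset\Gamma^n_\varepsilon(A)\subset\mathrm{Spec}_{\varepsilon+\varepsilon'_n(A)+2\|C\|}A,$$ in particular $$\mathrm{Spec}\,A\subset\Gamma^n_0(A)\subset\mathrm{Spec}_{\varepsilon'_n(A)+2\|C\|}A,$$ where $C$, $\varepsilon_n'(A)$ and the $\tau_1$-method inclusion set $\Gamma^n_\varepsilon(A)$ are defined in the context.
   Context: All norms are (spectral) $2$-norms; $s_{\min}(E):=\min_{\|x\|=1}\|Ex\|$ denotes the smallest singular value of a (square or tall) matrix $E$. For a square complex matrix $E$ and $\varepsilon\ge0$, $\mathrm{Spec}_\varepsilon E:=\{\lambda\in\mathbb{C}: s_{\min}(E-\lambda I)\le\varepsilon\}$; $\mathrm{Spec}_0E=\mathrm{Spec}\,E$ is the set of eigenvalues. Tridiagonal part: $B=[b_{ij}]_{i,j=1}^N$ with $b_{ij}:=a_{ij}$ if $|i-j|\le1$ and $b_{ij}:=0$ otherwise; remaining part $C:=A-B$. Put $r_L(A):=\max_{1\le i\le N-1}\|a_{i+1,i}\|$, $r_U(A):=\max_{1\le i\le N-1}\|a_{i,i+1}\|$, $r(A):=r_L(A)+r_U(A)$, and for $n\in\mathbb{N}$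 $$\varepsilon'_n(A):=2r(A)\sin\left(\frac{\pi}{2n+2}\right)+\|C\|.$$ For $n=1,\ldots,N$ and $k=0,\ldots,N-n$, $B_{n,k}:=[b_{ij}]_{i,j=k+1}^{k+n}$. Let $b_{0,1}$ and $b_{N+1,N}$ be zero matrices of dimensions $1\times m_1$ and $1\times m_N$. $B^+_{n,k}$ is the $(n+2)\times n$ block matrix whose first block row is $(b_{k,k+1},0,\ldots,0)$, whose middle $n$ block rows are $B_{n,k}$, and whose last block row is $(0,\ldots,0,b_{k+n+1,k+n})$, with zero blocks of consistent dimensions (for $n=1$ the first and last block rows are $b_{k,k+1}$ and $b_{k+2,k+1}$). Let $I^+_n$ be the block matrix of the same dimensions and block sizes as $B^+_{n,k}$ whose first and last block rows are zero and whose middle $n$ block rows form the identity matrix. For such a rectangular matrix, $\mathrm{Spec}_\varepsilon B^+_{n,k}:=\{\lambda\in\mathbb{C}: s_{\min}(B^+_{n,k}-\lambda I^+_n)\le\varepsilon\}$. For $\varepsilon\ge0$ and $n=1,\ldots,N-1$, $\Gamma^n_\varepsilon(A):=\bigcup_{k=0}^{N-n}\mathrm{Spec}_{\varepsilon+\varepsilon'_n(A)}B^+_{n,k}$. *)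

(* Defs.v *)
From HB Require Import structures.
From mathcomp Require Import all_boot all_order all_algebra.
From mathcomp Require Import complex.
From mathcomp Require Import all_classical all_reals all_analysis.

Set Implicit Arguments.
Unset Strict Implicit.
Unset Printing Implicit Defensive.

Import Order.TTheory GRing.Theory Num.Theory.

Local Open Scope classical_set_scope.
Local Open Scope ring_scope.
Local Open Scope complex_scope.

Definition vnorm (R : realType) (n : nat) (x : 'cV[R[i]]_n) : R :=
  Num.sqrt (\sum_(i < n) ComplexField.Normc.normc (x i 0) ^+ 2).

(* In the next two definitions the extremum over the unit sphere is attained
   as soon as p > 0, hence it is the usual maximum, resp. minimum. *)
Definition opnorm (R : realType) (q p : nat) (E : 'M[R[i]]_(q, p)) : R :=
  sup [set vnorm (E *m x) | x in [set x : 'cV[R[i]]_p | vnorm x = 1]].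

Definition smin (R : realType) (q p : nat) (E : 'M[R[i]]_(q, p)) : R :=
  inf [set vnorm (E *m x) | x in [set x : 'cV[R[i]]_p | vnorm x = 1]].

Definition pspec (R : realType) (p : nat) (eps : R) (E : 'M[R[i]]_p) :
    set R[i] :=
  [set l | smin (E - l%:M) <= eps].

(* Pseudospectrum of a rectangular E relative to J, which plays the role of
   the identity. *)
Definition rpspec (R : realType) (q p : nat) (eps : R)
    (E J : 'M[R[i]]_(q, p)) : set R[i] :=
  [set l | smin (E - l *: J) <= eps].

Definition spec (R : realType) (p : nat) (E : 'M[R[i]]_p) : set R[i] :=
  [set l | eigenvalue E l].

Section Blocks.
Variables (R : realType) (N : nat) (m : 'I_N -> nat).
Implicit Types A : 'M[R[i]]_(\sum_i m i).

Definition tridiag A : 'M[R[i]]_(\sum_i m i) :=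
  \mxblock_(i < N, j < N)
    (if ((i <= j.+1) && (j <= i.+1))%N then submxblock A i j else 0).

Definition remaining A : 'M[R[i]]_(\sum_i m i) := A - tridiag A.

Definition rL A : R :=
  \big[Num.max/0]_(p : 'I_N * 'I_N | p.1 == p.2.+1 :> nat)
    opnorm (submxblock A p.1 p.2).

Definition rU A : R :=
  \big[Num.max/0]_(p : 'I_N * 'I_N | p.2 == p.1.+1 :> nat)
    opnorm (submxblock A p.1 p.2).

Definition rLU A : R := rL A + rU A.

Definition eps' (n : nat) A : R :=
  2 * rLU A * sin (pi / (2 * n + 2)%:R) + opnorm (remaining A).

(* Blocks b_{i,j} with 1-based indices i, j : nat. Out-of-range indices
   (0 and N.+1 are the only ones used) get size 1 and zero blocks. *)
Definition oidx (i : nat) : option 'I_N :=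
  if i is i'.+1 then insub i' else None.

Definition osize (o : option 'I_N) : nat := if o is Some i then m i else 1%N.

Definition oblock (B : 'M[R[i]]_(\sum_i m i)) (o o' : option 'I_N) :
    'M[R[i]]_(osize o, osize o') :=
  match o, o' with
  | Some i, Some j => submxblock B i j
  | _, _ => 0
  end.

Definition bsize (i : nat) : nat := osize (oidx i).

Definition bblock A (i j : nat) : 'M[R[i]]_(bsize i, bsize j) :=
  oblock (tridiag A) (oidx i) (oidx j).

Definition Bsub A (n k : nat) : 'M[R[i]]_(\sum_(i < n) bsize (k + i.+1)) :=
  \mxblock_(i < n, j < n) bblock A (k + i.+1) (k + j.+1).

Definition Btop A (n k : nat) :
    'M[R[i]]_(bsize k, \sum_(j < n) bsize (k + j.+1)) :=
  \mxrow_(j < n) (if j == 0%N :> nat then bblock A k (k + j.+1) else 0).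

Definition Bbot A (n k : nat) :
    'M[R[i]]_(bsize (k + n.+1), \sum_(j < n) bsize (k + j.+1)) :=
  \mxrow_(j < n)
    (if j.+1 == n then bblock A (k + n.+1) (k + j.+1) else 0).

Definition Bplus A (n k : nat) :
    'M[R[i]]_(bsize k + (\sum_(i < n) bsize (k + i.+1) + bsize (k + n.+1)),
              \sum_(j < n) bsize (k + j.+1)) :=
  col_mx (Btop A n k) (col_mx (Bsub A n k) (Bbot A n k)).

Definition Iplus (n k : nat) :
    'M[R[i]]_(bsize k + (\sum_(i < n) bsize (k + i.+1) + bsize (k + n.+1)),
              \sum_(j < n) bsize (k + j.+1)) :=
  col_mx 0 (col_mx 1%:M 0).

Definition Gamma (n : nat) (eps : R) A : set R[i] :=
  \bigcup_(k in [set k : nat | (k <= N - n)%N])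
    rpspec (eps + eps' n A) (Bplus A n k) (Iplus n k).

End Blocks.

(* Main.v *)
Require Import Defs.
From mathcomp Require Import all_boot all_order all_algebra.
From mathcomp Require Import complex.
From mathcomp Require Import all_classical all_reals all_analysis.
From mathcomp Require Import zify ring lra.

Set Implicit Arguments.
Unset Strict Implicit.
Unset Printing Implicit Defensive.

Import Order.TTheory GRing.Theory Num.Theory.

Local Open Scope classical_set_scope.
Local Open Scope ring_scope.
Local Open Scope complex_scope.

(** The inclusion of the pseudospectrum in [Gamma] is a weighted averaging
    argument.  Write [B] for the tridiagonal part and let [x] be any vector.
    Multiply the blocks of [x] by the weights [sin (i pi / (n + 1))],
    [0 <= i <= n + 1], placed at the position [p]; this localizes [x] to a
    vector [x_p] supported in at most [n] consecutive blocks.  Commuting the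
    weights with [B] costs only the differences of neighbouring weights times
    off-diagonal blocks.  Summed over all positions [p], the squared weights
    give the same constant [S] for every block, and their squared differences
    give [(2 sin (pi / (2 n + 2)))^2 S], because the weights are the lowest
    eigenvector of the discrete Dirichlet Laplacian.  Minkowski's inequality
    then shows that if all localized vectors satisfy
    [mu |x_p| <= |(B - l) x_p|], then
    [mu |x| <= |(B - l) x| + 2 r sin (pi / (2 n + 2)) |x|]
    ([weight_variation], [tridiag_damp], [averaging]).

    The rectangular matrices fit in because [B - l] couples a block only with
    its neighbours: for a vector supported in the window of [n] blocks starting
    after the [k]-th one, [(B+_{n,k} - l I+)] applied to its restriction has the
    same norm as [B - l] applied to the whole vector, the extra first and last
    block rows recording what leaks out of the window
    ([vnorm_mulmx_window]).  So [smin (B+_{n,k} - l I+)] is the minimum of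
    [|(B - l) x|] over unit vectors [x] supported in the window.  With [mu] the
    least of these numbers over [k], averaging bounds [smin (A - l)] from below
    by [mu - eps' n A], which is the first inclusion
    ([pspec_sub_Gamma]).  The second is immediate: a minimum over fewer vectors
    is larger, and replacing [B] by [A] costs the norm of the remaining part
    ([Gamma_sub_pspec]). *)

(** * Euclidean norms, operator norm and smallest singular value *)

Section EuclideanNorm.
Variables (R : rcfType) (I : finType).
Implicit Types f g : I -> R.

Definition l2 f : R := Num.sqrt (\sum_i f i ^+ 2).

Lemma l2_ge0 f : 0 <= l2 f.
Proof. exact: sqrtr_ge0. Qed.

Lemma sqr_l2 f : l2 f ^+ 2 = \sum_i f i ^+ 2.
Proof. by rewrite sqr_sqrtr// sumr_ge0// => i _; rewrite sqr_ge0. Qed.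

Lemma eq_l2 f g : f =1 g -> l2 f = l2 g.
Proof. by move=> fg; congr Num.sqrt; apply: eq_bigr => i _; rewrite fg. Qed.

Lemma l2_eqsqr f (c : R) : 0 <= c -> c ^+ 2 = \sum_i f i ^+ 2 -> l2 f = c.
Proof. by move=> c0 cf; rewrite /l2 -cf sqrtr_sqr ger0_norm. Qed.

Lemma l2_le f g : (forall i, 0 <= f i <= g i) -> l2 f <= l2 g.
Proof.
move=> fg; apply: ler_wsqrtr; apply: ler_sum => i _.
by have /andP[f0 fgi] := fg i; rewrite lerXn2r// nnegrE ?(le_trans f0).
Qed.

Lemma l2_scale (c : R) f : 0 <= c -> l2 (fun i => c * f i) = c * l2 f.
Proof.
move=> c0; apply: l2_eqsqr; first by rewrite mulr_ge0 ?l2_ge0.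
by rewrite exprMn sqr_l2 mulr_sumr; apply: eq_bigr => i _; rewrite exprMn.
Qed.

Lemma l2_eq0 f i : l2 f = 0 -> f i = 0.
Proof.
move=> /(congr1 (fun t => t ^+ 2)); rewrite sqr_l2 expr0n/= => /eqP.
rewrite psumr_eq0 => [/allP/(_ i)|j _]; last exact: sqr_ge0.
by rewrite mem_index_enum sqrf_eq0 => /(_ isT)/eqP.
Qed.

(** Summing [2 s t f g <= t^2 f^2 + s^2 g^2] with [s], [t] the two norms gives
    the inequality multiplied by [2 s t]. *)
Lemma cauchy_schwarz f g : \sum_i f i * g i <= l2 f * l2 g.
Proof.
have [f0|f0] := eqVneq (l2 f) 0.
  by rewrite f0 mul0r big1// => i _; rewrite (l2_eq0 i f0) mul0r.
have [g0|g0] := eqVneq (l2 g) 0.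
  by rewrite g0 mulr0 big1// => i _; rewrite (l2_eq0 i g0) mulr0.
set s := l2 f in f0 *; set t := l2 g in g0 *.
have s0 : 0 < s by rewrite lt_def f0 l2_ge0.
have t0 : 0 < t by rewrite lt_def g0 l2_ge0.
have st0 : 0 < 2 * (s * t) by rewrite !mulr_gt0.
rewrite -(ler_pM2l st0).
have -> : 2 * (s * t) * (s * t) =
    \sum_i (t ^+ 2 * f i ^+ 2 + s ^+ 2 * g i ^+ 2).
  by rewrite big_split/= -!mulr_sumr -!sqr_l2 -/s -/t; ring.
rewrite mulr_sumr; apply: ler_sum => i _; rewrite -subr_ge0.
have -> : t ^+ 2 * f i ^+ 2 + s ^+ 2 * g i ^+ 2 - 2 * (s * t) * (f i * g i)
   = (t * f i - s * g i) ^+ 2 by ring.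
exact: sqr_ge0.
Qed.

Lemma minkowski f g : l2 (fun i => f i + g i) <= l2 f + l2 g.
Proof.
rewrite -[leRHS]ger0_norm ?addr_ge0 ?l2_ge0// -sqrtr_sqr.
apply: ler_wsqrtr.
have -> : \sum_i (f i + g i) ^+ 2 =
    l2 f ^+ 2 + 2 * (\sum_i f i * g i) + l2 g ^+ 2.
  rewrite !sqr_l2 mulr_sumr -!big_split/=; apply: eq_bigr => i _; ring.
have := cauchy_schwarz f g; nra.
Qed.

End EuclideanNorm.

Section VectorNorm.
Variable R : realType.
Implicit Types (p q : nat).

Import ComplexField.Normc.

Lemma normc_ge0 (z : R[i]) : 0 <= normc z.
Proof. by case: z => a b; exact: sqrtr_ge0. Qed.

Lemma normc_real (a : R) : normc a%:C = `|a|.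
Proof. by rewrite /= expr0n/= addr0 sqrtr_sqr. Qed.

Lemma vnormE p (x : 'cV[R[i]]_p) : vnorm x = l2 (fun i => normc (x i 0)).
Proof. by []. Qed.

Lemma vnorm_ge0 p (x : 'cV[R[i]]_p) : 0 <= vnorm x.
Proof. exact: l2_ge0. Qed.

Lemma vnorm0 p : vnorm (0 : 'cV[R[i]]_p) = 0.
Proof.
apply: l2_eqsqr => //; rewrite expr0n big1// => i _.
by rewrite mxE normc0 expr0n.
Qed.

Lemma vnorm_eq0 p (x : 'cV[R[i]]_p) : vnorm x = 0 -> x = 0.
Proof.
move=> x0; apply/matrixP => i j; rewrite ord1 mxE; apply: eq0_normc.
exact: (l2_eq0 i x0).
Qed.

Lemma vnormZ p (a : R[i]) (x : 'cV[R[i]]_p) :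
  vnorm (a *: x) = normc a * vnorm x.
Proof.
rewrite !vnormE -l2_scale ?normc_ge0//; apply: eq_l2 => i.
by rewrite mxE normcM.
Qed.

Lemma vnormN p (x : 'cV[R[i]]_p) : vnorm (- x) = vnorm x.
Proof. by rewrite !vnormE; apply: eq_l2 => i; rewrite mxE normcN. Qed.

Lemma vnormD p (x y : 'cV[R[i]]_p) : vnorm (x + y) <= vnorm x + vnorm y.
Proof.
rewrite !vnormE; apply: le_trans (minkowski _ _); apply: l2_le => i.
by rewrite normc_ge0 mxE le_normcD.
Qed.

Lemma vnorm_sum (J : Type) (r : seq J) (P : pred J) p (F : J -> 'cV[R[i]]_p) :
  vnorm (\sum_(j <- r | P j) F j) <= \sum_(j <- r | P j) vnorm (F j).
Proof.
elim/big_ind2: _ => [|x a y b xa yb|//]; first by rewrite vnorm0.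
exact: le_trans (vnormD _ _) (lerD xa yb).
Qed.

Lemma vnorm_coord p (x : 'cV[R[i]]_p) j : normc (x j 0) <= vnorm x.
Proof.
rewrite vnormE -[leLHS]ger0_norm ?normc_ge0// -sqrtr_sqr; apply: ler_wsqrtr.
by rewrite (bigD1 j)//= lerDl sumr_ge0// => i _; rewrite sqr_ge0.
Qed.

Lemma sqr_vnorm_col_mx p q (x : 'cV[R[i]]_p) (y : 'cV[R[i]]_q) :
  vnorm (col_mx x y) ^+ 2 = vnorm x ^+ 2 + vnorm y ^+ 2.
Proof.
rewrite !vnormE !sqr_l2 big_split_ord/=; congr (_ + _).
  by apply: eq_bigr => i _; rewrite col_mxEu.
by apply: eq_bigr => i _; rewrite col_mxEd.
Qed.

Lemma sqr_vnorm_mxcol (N : nat) (m : 'I_N -> nat)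
    (x : forall i, 'cV[R[i]]_(m i)) :
  vnorm (\mxcol_i x i) ^+ 2 = \sum_i vnorm (x i) ^+ 2.
Proof.
rewrite vnormE sqr_l2; under [RHS]eq_bigr do rewrite vnormE sqr_l2.
rewrite sig_big_dep/= (reindex _ tagnat.sig_bij_on)/=.
by apply: eq_bigr => s _; rewrite !mxE.
Qed.

Lemma vnorm_mxcol (N : nat) (m : 'I_N -> nat) (x : forall i, 'cV[R[i]]_(m i)) :
  vnorm (\mxcol_i x i) = l2 (fun i => vnorm (x i)).
Proof. by rewrite -(l2_eqsqr (vnorm_ge0 _) (sqr_vnorm_mxcol x)). Qed.

Lemma vnorm_normalize p (x : 'cV[R[i]]_p) : x != 0 ->
  vnorm ((vnorm x)^-1%:C *: x) = 1.
Proof.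
move=> x0; have nx0 : vnorm x != 0 by apply: contra_neq x0; exact: vnorm_eq0.
rewrite vnormZ normc_real ger0_norm ?invr_ge0 ?vnorm_ge0//.
by rewrite mulVf.
Qed.

Lemma unit_sphere_neq0 p : (0 < p)%N -> exists x : 'cV[R[i]]_p, vnorm x = 1.
Proof.
move=> p0; have x0 : (const_mx 1 : 'cV[R[i]]_p) != 0.
  apply/eqP => /matrixP/(_ (Ordinal p0) 0)/eqP.
  by rewrite !mxE oner_eq0.
by exists ((vnorm (const_mx 1 : 'cV[R[i]]_p))^-1%:C *: const_mx 1);
  exact: vnorm_normalize.
Qed.

Lemma mulmx_scale_vnorm q p (E : 'M[R[i]]_(q, p)) (x : 'cV[R[i]]_p) :
  vnorm (E *m x) = vnorm x * vnorm (E *m ((vnorm x)^-1%:C *: x)).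
Proof.
have [->|x0] := eqVneq x 0; first by rewrite mulmx0 !vnorm0 mul0r.
have nx0 : vnorm x != 0 by apply: contra_neq x0; exact: vnorm_eq0.
rewrite -scalemxAr vnormZ normc_real ger0_norm ?invr_ge0 ?vnorm_ge0//.
by rewrite mulVKf.
Qed.

(** Makes the supremum defining [opnorm] finite: on the unit sphere every
    coordinate is at most 1, so the sum of the column norms is a bound. *)
Lemma mulmx_bounded q p (E : 'M[R[i]]_(q, p)) :
  has_ubound [set vnorm (E *m x) | x in [set x : 'cV[R[i]]_p | vnorm x = 1]].
Proof.
exists (\sum_j vnorm (col j E)) => _ [x /= x1 <-].
have -> : E *m x = \sum_j x j 0 *: col j E.
  apply/matrixP => i k; rewrite ord1 mxE summxE; apply: eq_bigr => j _.
  by rewrite !mxE mulrC.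
apply: le_trans (vnorm_sum _ _ _) _; apply: ler_sum => j _.
rewrite vnormZ ler_piMl ?vnorm_ge0//; apply: le_trans (vnorm_coord x j) _.
by rewrite x1.
Qed.

Lemma opnorm_ge q p (E : 'M[R[i]]_(q, p)) (x : 'cV[R[i]]_p) :
  vnorm (E *m x) <= opnorm E * vnorm x.
Proof.
have [->|x0] := eqVneq x 0; first by rewrite mulmx0 !vnorm0 mulr0.
rewrite mulmx_scale_vnorm mulrC ler_wpM2r ?vnorm_ge0//.
apply: ub_le_sup; first exact: mulmx_bounded.
by exists ((vnorm x)^-1%:C *: x) => //=; exact: vnorm_normalize.
Qed.

Lemma opnorm_ge0 q p (E : 'M[R[i]]_(q, p)) : 0 <= opnorm E.
Proof.
have [[[_ [x x1 _]] ubE]|/sup_out] := pselect (has_sup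
  [set vnorm (E *m x) | x in [set x : 'cV[R[i]]_p | vnorm x = 1]]).
  by apply: le_trans (vnorm_ge0 (E *m x)) _; apply: ub_le_sup => //; exists x.
by rewrite /opnorm => ->.
Qed.

(** Together with [le_smin], this says that [smin E] is the largest [c] such
    that [c * vnorm x <= vnorm (E *m x)] for all [x], provided there is a
    nonzero [x].  All later estimates of [smin] go through this pair. *)
Lemma smin_le q p (E : 'M[R[i]]_(q, p)) (x : 'cV[R[i]]_p) :
  smin E * vnorm x <= vnorm (E *m x).
Proof.
have [->|x0] := eqVneq x 0; first by rewrite mulmx0 !vnorm0 mulr0.
rewrite mulmx_scale_vnorm mulrC ler_wpM2l ?vnorm_ge0//.
apply: ge_inf; first by exists 0 => _ [y _ <-]; exact: vnorm_ge0.
by exists ((vnorm x)^-1%:C *: x) => //=; exact: vnorm_normalize.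
Qed.

Lemma le_smin q p (E : 'M[R[i]]_(q, p)) (c : R) : (0 < p)%N ->
  (forall x : 'cV[R[i]]_p, c * vnorm x <= vnorm (E *m x)) -> c <= smin E.
Proof.
move=> p0 cE; apply: lb_le_inf.
  by have [x x1] := unit_sphere_neq0 p0; exists (vnorm (E *m x)), x.
by move=> _ [x /= x1 <-]; rewrite -[c]mulr1 -x1.
Qed.

Lemma smin_ge0 q p (E : 'M[R[i]]_(q, p)) : (0 < p)%N -> 0 <= smin E.
Proof. by move=> p0; apply: le_smin => // x; rewrite mul0r vnorm_ge0. Qed.

(** [eigenvalue] is phrased with left eigenvectors; a singular matrix also
    kills a nonzero column. *)
Lemma eigenvalue_smin p (E : 'M[R[i]]_p) (l : R[i]) :
  eigenvalue E l -> smin (E - l%:M) <= 0.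
Proof.
move=> /eigenvalueP[v vE v0].
have : \det (E - l%:M)^T == 0.
  rewrite det_tr; apply/det0P; exists v => //.
  by rewrite mulmxBr vE mul_mx_scalar subrr.
move=> /det0P[u u0 uE]; have Eu : (E - l%:M) *m u^T = 0.
  by apply: trmx_inj; rewrite trmx_mul trmxK uE trmx0.
have := smin_le (E - l%:M) u^T; rewrite Eu vnorm0 pmulr_lle0//.
rewrite lt_def vnorm_ge0 andbT; apply: contra_neq u0 => /vnorm_eq0 uT0.
by apply: trmx_inj; rewrite uT0 trmx0.
Qed.

End VectorNorm.

(** * Windows of consecutive blocks *)

Lemma submxcolZ (R : pzRingType) (p q : nat) (p_ : 'I_p -> nat) (a : R)
    (B : 'M[R]_(\sum_i p_ i, q)) i : submxcol (a *: B) i = a *: submxcol B i.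
Proof. by apply/matrixP => j k; rewrite !mxE. Qed.

Section Windows.
Variables (R : realType) (N : nat) (m : 'I_N -> nat).
Variables (A : 'M[R[i]]_(\sum_i m i)) (l : R[i]).

Lemma oidx_eq i (j : 'I_N) : (oidx N i == Some j) = (i == j.+1).
Proof.
case: i => [|i] //=; case: insubP => [u _ /= ui|iN].
  by rewrite eqSS -ui; apply/eqP/eqP => [[->]//|/val_inj->].
by symmetry; apply: contraNF iN => /eqP[->].
Qed.

(** Reindexing between a window, whose positions are natural numbers that may
    stick out of the matrix, and the actual block indices.  Out-of-range
    positions are all sent to [None], where [G] vanishes; distinct in-range
    positions have distinct indices.  Taking [G] on [option 'I_N] lets the same
    statement serve for families of blocks of varying sizes without casts. *)
Lemma sum_oidx (V : nmodType) (G : option 'I_N -> V) k q : G None = 0 ->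
  (forall j : 'I_N, ~~ (k <= j.+1 < k + q)%N -> G (Some j) = 0) ->
  \sum_(i < q) G (oidx N (k + i)) = \sum_j G (Some j).
Proof.
move=> G0 GS.
have GE o : G o = \sum_(j | o == Some j) G (Some j).
  case: o => [j0|]; last by rewrite big_pred0.
  by rewrite (big_pred1 j0)// => j; rewrite eq_sym.
under eq_bigr => i _ do rewrite GE.
rewrite (exchange_big_dep predT)//=; apply: eq_bigr => j _.
have [/andP[kj jk]|out] := boolP (k <= j.+1 < k + q)%N; last first.
  by rewrite (GS _ out) big1.
have jq : (j.+1 - k < q)%N by lia.
rewrite (big_pred1 (Ordinal jq))// => i; rewrite /= oidx_eq -val_eqE/=.
by lia.
Qed.

Lemma sum_oidxS (V : nmodType) (G : option 'I_N -> V) k q : G None = 0 ->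
  (forall j : 'I_N, ~~ (k <= j < k + q)%N -> G (Some j) = 0) ->
  \sum_(i < q) G (oidx N (k + i.+1)) = \sum_j G (Some j).
Proof.
move=> G0 GS; rewrite -(@sum_oidx _ G k.+1 q)//.
by apply: eq_bigr => i _; rewrite addSnnS.
Qed.

Lemma submxblock_tridiag i j : submxblock (tridiag A) i j =
  if ((i <= j.+1) && (j <= i.+1))%N then submxblock A i j else 0.
Proof. by rewrite mxblockK. Qed.

Lemma oblock_tridiag_eq0 (o o' : option 'I_N) :
  (forall a b : 'I_N, o = Some a -> o' = Some b ->
    ~~ ((a <= b.+1) && (b <= a.+1))%N) ->
  oblock (tridiag A) o o' = 0.
Proof.
case: o o' => [a|] [b|]//= /(_ a b erefl erefl) /negbTE ab.
by rewrite submxblock_tridiag ab.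
Qed.

Lemma bblock_eq0 i j : ~~ ((i <= j.+1) && (j <= i.+1))%N -> bblock A i j = 0.
Proof.
move=> ij; apply: oblock_tridiag_eq0 => a b /eqP ia /eqP jb.
by move: ia jb ij; rewrite !oidx_eq; lia.
Qed.

(** Block vectors are given by families [X] over [option 'I_N], because the
    blocks of a window are indexed through [oidx]: then the vector of full
    length and its restriction to a window are both read off from [X], with
    sizes that agree by definition. *)
Definition glue (X : forall o, 'cV[R[i]]_(osize m o)) :
  'cV[R[i]]_(\sum_i m i) := \mxcol_j X (Some j).

Definition window (X : forall o, 'cV[R[i]]_(osize m o)) n k :
  'cV[R[i]]_(\sum_(i < n) bsize m (k + i.+1)) :=
  \mxcol_(i < n) X (oidx N (k + i.+1)).

Definition supported (X : forall o, 'cV[R[i]]_(osize m o)) n k :=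
  X None = 0 /\ forall j : 'I_N, ~~ (k <= j < k + n)%N -> X (Some j) = 0.

Lemma vnorm_window X n k : supported X n k ->
  vnorm (window X n k) = vnorm (glue X).
Proof.
move=> [X0 XS]; rewrite /window vnorm_mxcol vnorm_mxcol.
apply: l2_eqsqr; first exact: l2_ge0.
rewrite sqr_l2 (@sum_oidxS _ (fun o => vnorm (X o) ^+ 2))//.
  by rewrite X0 vnorm0 expr0n.
by move=> j /XS ->; rewrite vnorm0 expr0n.
Qed.

Let residual (X : forall o, 'cV[R[i]]_(osize m o)) o : 'cV[R[i]]_(osize m o) :=
  \sum_j oblock (tridiag A) o (Some j) *m X (Some j) - l *: X o.

Lemma mulmx_glue X :
  (tridiag A - l%:M) *m glue X = \mxcol_j residual X (Some j).
Proof.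
rewrite mulmxBl mul_scalar_mx.
rewrite {1}/tridiag mul_mxblock_mxrow /residual.
apply/mxcolP => i; rewrite submxcolB submxcolZ !mxcolK; congr (_ - _).
by apply: eq_bigr => j _ /=; rewrite submxblock_tridiag.
Qed.

(** The first and last block rows hold only one block each, but the blocks that
    are missing there lie outside the tridiagonal band, and [l] times the
    identity contributes nothing, as [X] vanishes just outside the window.  So
    every block row of the product is the corresponding row of
    [(tridiag A - l%:M) *m glue X]. *)
Lemma mulmx_window X n k : supported X n k ->
  (Bplus A n k - l *: Iplus R m n k) *m window X n k =
  col_mx (residual X (oidx N k))
    (col_mx (\mxcol_(i < n) residual X (oidx N (k + i.+1)))
            (residual X (oidx N (k + n.+1)))).
Proof.
move=> [X0 XS].
have rowE o : \sum_(i < n) oblock (tridiag A) o (oidx N (k + i.+1)) *m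
      X (oidx N (k + i.+1)) =
    \sum_j oblock (tridiag A) o (Some j) *m X (Some j).
  rewrite (@sum_oidxS _ (fun o' => oblock (tridiag A) o o' *m X o'))//.
    by rewrite X0 mulmx0.
  by move=> j /XS ->; rewrite mulmx0.
have outE i : ~~ (k < i < k + n.+1)%N -> X (oidx N i) = 0.
  move=> ik; case E : (oidx N i) => [j|//]; apply: XS.
  by move/eqP: E; rewrite oidx_eq; lia.
rewrite mulmxBl -scalemxAl /Bplus /Iplus !mul_col_mx !mul0mx mul1mx.
rewrite !scale_col_mx !scaler0 !opp_col_mx !add_col_mx oppr0 !addr0.
congr col_mx; [|congr col_mx].
- rewrite /residual outE ?ltnn// scaler0 subr0 /Btop /window mul_mxrow_mxcol.
  rewrite -rowE; apply: eq_bigr => i _; case: eqVneq => // i0.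
  by rewrite -/(bblock A k (k + i.+1)) bblock_eq0 ?mul0mx//; lia.
- rewrite /Bsub /window mul_mxblock_mxrow.
  apply/mxcolP => i; rewrite submxcolB submxcolZ !mxcolK /residual.
  by rewrite -rowE.
- rewrite /residual outE ?ltnn ?andbF// scaler0 !subr0 /Bbot
    /window mul_mxrow_mxcol.
  rewrite -rowE; apply: eq_bigr => i _; case: eqVneq => // i0.
  rewrite -/(bblock A (k + n.+1) (k + i.+1)) bblock_eq0 ?mul0mx//.
  by have := ltn_ord i; lia.
Qed.

(** By bandedness, [tridiag A] spreads the support by at most one block on each
    side, so the [n + 2] block rows seen by the rectangular matrix are all the
    nonzero ones.  A row beyond an end of the matrix has index [None] and
    residual zero. *)
Lemma vnorm_mulmx_window X n k : supported X n k ->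
  vnorm ((Bplus A n k - l *: Iplus R m n k) *m window X n k) =
  vnorm ((tridiag A - l%:M) *m glue X).
Proof.
move=> sX; have [X0 XS] := sX; rewrite mulmx_window// mulmx_glue.
apply: (@pexpIrn _ 2) => //; rewrite ?nnegrE ?vnorm_ge0//.
rewrite !sqr_vnorm_col_mx !sqr_vnorm_mxcol.
pose G o := vnorm (residual X o) ^+ 2.
rewrite -(@sum_oidx _ G k n.+2).
- by rewrite big_ord_recl/= big_ord_recr/= addn0.
- rewrite /G /residual X0 scaler0 subr0 big1 ?vnorm0 ?expr0n// => j _.
  by rewrite mul0mx.
- move=> j jk; rewrite /G /residual XS; last by lia.
  rewrite scaler0 subr0 big1 ?vnorm0 ?expr0n// => j' _.
  have [j'k|/XS ->] := boolP (k <= j' < k + n)%N; last by rewrite mulmx0.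
  by rewrite oblock_tridiag_eq0 ?mul0mx// => a b [<-] [<-]; lia.
Qed.

(** A window inside the matrix imposes no condition on the vector: extend it by
    zero.  The block with index [o] is found by summing over the single
    position [i] such that [oidx N (k + i.+1) == o], where [conform_mx] is the
    identity; this avoids transporting along an equality of block sizes. *)
Lemma window_surj n k (z : 'cV[R[i]]_(\sum_(i < n) bsize m (k + i.+1))) :
  (k + n <= N)%N -> exists2 X, supported X n k & window X n k = z.
Proof.
move=> knN.
pose X o : 'cV[R[i]]_(osize m o) :=
  \sum_(i < n | oidx N (k + i.+1) == o) conform_mx 0 (submxcol z i).
exists X.
  split=> [|j jk]; rewrite /X big_pred0// => i.
    have iN : (k + i < N)%N by have := ltn_ord i; lia.
    by rewrite addnS /= insubT.
  by rewrite oidx_eq; have := ltn_ord i; lia.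
rewrite -[z]submxcolK; apply: eq_mxcol => i0.
rewrite /X (big_pred1 i0) ?conform_mx_id// => i /=.
have iN : (k + i0 < N)%N by have := ltn_ord i0; lia.
have -> : oidx N (k + i0.+1) = Some (Ordinal iN).
  by apply/eqP; rewrite oidx_eq/= addnS.
by rewrite oidx_eq /= -val_eqE/=; lia.
Qed.

Lemma smin_window_le n k (x : 'cV[R[i]]_(\sum_i m i)) :
  (forall j : 'I_N, ~~ (k <= j < k + n)%N -> submxcol x j = 0) ->
  smin (Bplus A n k - l *: Iplus R m n k) * vnorm x <=
    vnorm ((tridiag A - l%:M) *m x).
Proof.
move=> xS.
pose X o : 'cV[R[i]]_(osize m o) := if o is Some j then submxcol x j else 0.
have sX : supported X n k by [].
have <- : glue X = x by rewrite -[RHS]submxcolK.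
by rewrite -(vnorm_window sX) -(vnorm_mulmx_window sX); exact: smin_le.
Qed.

Lemma bsize_gt0 i : (forall j, 0 < m j)%N -> (0 < bsize m i)%N.
Proof. by move=> m0; rewrite /bsize; case: oidx => [j|//]; exact: m0. Qed.

Lemma sum_bsize_gt0 n k : (forall j, 0 < m j)%N -> (0 < n)%N ->
  (0 < \sum_(i < n) bsize m (k + i.+1))%N.
Proof.
by case: n => // n m0 _; rewrite big_ord_recl addn_gt0 bsize_gt0.
Qed.

Lemma le_smin_window n k (c : R) :
  (forall j, 0 < m j)%N -> (0 < n)%N -> (k + n <= N)%N ->
  (forall x : 'cV[R[i]]_(\sum_i m i),
    c * vnorm x <= vnorm ((tridiag A - l%:M) *m x)) ->
  c <= smin (Bplus A n k - l *: Iplus R m n k).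
Proof.
move=> m0 n0 knN cB; apply: le_smin; first exact: sum_bsize_gt0.
move=> z; have [X sX <-] := window_surj z knN.
by rewrite (vnorm_window sX) (vnorm_mulmx_window sX).
Qed.

End Windows.

(** * Sine weights and averaging over window positions *)

Section Weights.
Variables (R : realType) (n : nat).

Let theta : R := pi / n.+1%:R.

(** The sine vanishes at [0] and at [n.+1], so truncating to zero beyond
    [n.+1] matches the extension by zero on both sides; as arguments are often
    truncated differences, negative positions also get weight zero. *)
Definition weight (l : nat) : R :=
  if (l <= n.+1)%N then sin (l%:R * theta) else 0.

Definition weight_mass : R := \sum_(l < n.+2) weight l ^+ 2.

Lemma weight0 : weight 0 = 0.
Proof. by rewrite /weight/= mul0r sin0. Qed.

Lemma weight_out l : (n < l)%N -> weight l = 0.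
Proof.
rewrite /weight leq_eqVlt => /predU1P[<-|nl].
  by rewrite leqnn /theta mulrC divfK ?pnatr_eq0// sinpi.
by rewrite leqNgt nl.
Qed.

Lemma weight_mass_gt0 : (0 < n)%N -> 0 < weight_mass.
Proof.
move=> n0; rewrite /weight_mass big_ord_recl big_ord_recl/=.
apply: ltr_wpDl; first exact: sqr_ge0.
apply: ltr_pwDl; last by apply: sumr_ge0 => i _; exact: sqr_ge0.
rewrite exprn_gt0// /weight/= mul1r sin_gt0_pi//.
rewrite /theta divr_gt0 ?pi_gt0 ?ltr0n//= ltr_pdivrMr ?ltr0n//.
by rewrite ltr_pMr ?pi_gt0// ltr1n.
Qed.

(** Summation by parts: the weights vanish at both ends and satisfy
    [w_(l+2) + w_l = 2 cos theta w_(l+1)], so the sum of the products of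
    neighbours is [cos theta S], and the variation is
    [2 (1 - cos theta) S = 4 sin^2 (theta / 2) S]. *)
Lemma weight_variation :
  \sum_(l < n.+1) (weight l.+1 - weight l) ^+ 2 =
  (2 * sin (pi / (2 * n + 2)%:R)) ^+ 2 * weight_mass.
Proof.
set S := weight_mass.
have S1 : \sum_(l < n.+1) weight l.+1 ^+ 2 = S.
  by rewrite /S /weight_mass [RHS]big_ord_recl/= weight0 expr0n/= add0r.
have S2 : \sum_(l < n.+1) weight l ^+ 2 = S.
  by rewrite /S /weight_mass [RHS]big_ord_recr/= weight_out// expr0n/= addr0.
pose P := \sum_(l < n.+1) weight l * weight l.+1.
have recur (l : 'I_n.+1) : weight l.+1 * weight l.+2 + weight l * weight l.+1 =
    2 * cos theta * weight l.+1 ^+ 2.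
  (* at the right end the recurrence would need a weight beyond n.+1, but all
     terms are multiplied by the weight at n.+1, which is 0 *)
  have [->|ln] := eqVneq (l : nat) n.
    by rewrite (@weight_out n.+1)//; ring.
  have ln' : (l < n)%N by have := ltn_ord l; lia.
  rewrite /weight !ifT; [|lia..].
  have -> : l.+2%:R * theta = l.+1%:R * theta + theta :> R.
    by rewrite -[l.+2%:R]natr1; ring.
  have -> : l%:R * theta = l.+1%:R * theta - theta :> R.
    by rewrite -[l.+1%:R]natr1; ring.
  by rewrite sinB sinD; ring.
have PE : 2 * P = 2 * cos theta * S.
  rewrite -S1 [RHS]mulr_sumr; under [RHS]eq_bigr => l _ do rewrite -recur.
  rewrite big_split/=.
  have -> : \sum_(l < n.+1) weight l.+1 * weight l.+2 = P.
    transitivity (\sum_(l < n.+2) weight l * weight l.+1).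
      by rewrite [RHS]big_ord_recl/= weight0 mul0r add0r.
    by rewrite big_ord_recr/= (@weight_out n.+1)// mul0r addr0.
  by rewrite -/P; ring.
transitivity (2 * S - 2 * P).
  have -> : 2 * S = \sum_(l < n.+1) weight l.+1 ^+ 2 +
      \sum_(l < n.+1) weight l ^+ 2 by rewrite S1 S2; ring.
  rewrite /P mulr_sumr -big_split/= -sumrB.
  by apply: eq_bigr => l _; ring.
rewrite PE.
have -> : theta = (pi / (2 * n + 2)%:R) *+ 2.
  rewrite /theta -mulrnAr -mulr_natr; congr (_ * _).
  rewrite (_ : 2 * n + 2 = 2 * n.+1)%N; last by lia.
  by rewrite natrM; field; rewrite nat1r pnatr_eq0.
by rewrite cos_mulr2n cos2sin2; ring.
Qed.

(** As the window position [p] runs over all values, the position [q - p] of a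
    fixed block inside the window runs over all values in reverse. *)
Lemma sum_reflect (g h : nat -> R) (q P k : nat) :
  (q < P)%N -> (k <= q.+1)%N -> (forall l, (k <= l)%N -> g l = 0) ->
  (forall p, (p <= q)%N -> h p = g (q - p)%N) ->
  (forall p, (q < p)%N -> h p = 0) ->
  \sum_(p < P) h p = \sum_(l < k) g l.
Proof.
move=> qP kq g0 hg h0; rewrite -(big_mkord xpredT h) -(big_mkord xpredT g).
rewrite (@big_cat_nat _ _ _ q.+1)//= [X in _ + X]big_nat
  [X in _ + X]big1 => [|p]; last first.
  by case/andP => + _ => /h0.
rewrite addr0 big_nat_rev/= add0n.
under eq_big_nat => p pq.
  rewrite hg; last by lia.
  rewrite (_ : q - (q.+1 - p.+1) = p)%N; last by lia.
  over.
rewrite (@big_cat_nat _ _ _ k)//= [X in _ + X]big_nat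
  [X in _ + X]big1 ?addr0// => p.
by case/andP => + _ => /g0.
Qed.

Lemma sum_sqr_weight q P : (n < q < P)%N ->
  \sum_(p < P) weight (q - p) ^+ 2 = weight_mass.
Proof.
move=> /andP[nq qP].
rewrite (@sum_reflect (fun l => weight l ^+ 2)
  (fun p => weight (q - p) ^+ 2) q P n.+2)//.
- by move=> l nl; rewrite weight_out ?expr0n//; exact: ltnW.
- by move=> p qp; rewrite (_ : q - p = 0)%N ?weight0 ?expr0n//; lia.
Qed.

Lemma sum_sqr_weight_diff q P : (n <= q)%N -> (q < P)%N ->
  \sum_(p < P) (weight (q.+1 - p) - weight (q - p)) ^+ 2 =
  (2 * sin (pi / (2 * n + 2)%:R)) ^+ 2 * weight_mass.
Proof.
move=> nq qP; rewrite -weight_variation.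
rewrite (@sum_reflect (fun l => (weight l.+1 - weight l) ^+ 2)
  (fun p => (weight (q.+1 - p) - weight (q - p)) ^+ 2) q P n.+1)//.
- by move=> l nl; rewrite !weight_out ?subr0 ?expr0n//; lia.
- by move=> p pq; rewrite subSn.
- move=> p qp; rewrite (_ : q - p = 0)%N; last by lia.
  by rewrite (_ : q.+1 - p = 0)%N ?subrr ?expr0n//; lia.
Qed.

End Weights.

Section Averaging.
Variables (R : realType) (N : nat) (m : 'I_N -> nat).
Variables (A : 'M[R[i]]_(\sum_i m i)).

Let below (i j : 'I_N) := i == j.+1 :> nat.
Let above (i j : 'I_N) := j == i.+1 :> nat.

Lemma submxcol_mul_tridiag (v : 'cV[R[i]]_(\sum_i m i)) i :
  submxcol (tridiag A *m v) i =
  submxblock A i i *m submxcol v i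
  + \sum_(j | below i j) submxblock A i j *m submxcol v j
  + \sum_(j | above i j) submxblock A i j *m submxcol v j.
Proof.
rewrite -[v in LHS]submxcolK {1}/tridiag mul_mxblock_mxrow mxcolK.
rewrite (bigD1 i)//= !leqnSn/= -addrA; congr (_ + _).
rewrite (bigID (below i))/=; congr (_ + _).
  rewrite (eq_bigl (below i)) => [|j]; last first.
    by rewrite /below -val_eqE/=; lia.
  by apply: eq_bigr => j; rewrite /below => ij; rewrite ifT//; lia.
rewrite (bigID (above i))/= addrC big1 ?add0r => [|j]; last first.
  by rewrite /below /above -val_eqE/= => ij; rewrite ifF ?mul0mx//; lia.
rewrite (eq_bigl (above i)) => [|j]; last first.
  by rewrite /below /above -val_eqE/=; lia.
by apply: eq_bigr => j; rewrite /above => ij; rewrite ifT//; lia.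
Qed.

Definition damp (c : 'I_N -> R) (v : 'cV[R[i]]_(\sum_i m i)) :
  'cV[R[i]]_(\sum_i m i) := \mxcol_j ((c j)%:C *: submxcol v j).

(** The part of the commutator of [tridiag A] with the weights [c] that comes
    from one off-diagonal. *)
Definition coupling (Q : rel 'I_N) (c : 'I_N -> R)
    (v : 'cV[R[i]]_(\sum_i m i)) : 'cV[R[i]]_(\sum_i m i) :=
  \mxcol_i \sum_(j | Q i j)
    ((c j - c i)%:C *: (submxblock A i j *m submxcol v j)).

(** Split each weight [c j] in row [i] as [c i + (c j - c i)]; the difference is
    zero on the diagonal. *)
Lemma tridiag_damp (l : R[i]) c v :
  (tridiag A - l%:M) *m damp c v =
  damp c ((tridiag A - l%:M) *m v) + coupling below c v + coupling above c v.
Proof.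
apply/mxcolP => i; rewrite !submxcolD !mxcolK.
rewrite !mulmxBl !mul_scalar_mx !submxcolB !submxcolZ !submxcol_mul_tridiag.
rewrite mxcolK -!scalemxAr.
have shift (Q : pred 'I_N) :
    \sum_(j | Q j) submxblock A i j *m submxcol (damp c v) j =
    (c i)%:C *: (\sum_(j | Q j) submxblock A i j *m submxcol v j) +
    \sum_(j | Q j) ((c j - c i)%:C *: (submxblock A i j *m submxcol v j)).
  rewrite scaler_sumr -big_split/=; apply: eq_bigr => j _.
  by rewrite mxcolK -scalemxAr -scalerDl -rmorphD/= addrCA subrr addr0.
rewrite !shift !scalerBr !scalerDr !scalerA [l * _]mulrC.
rewrite -!addrA; congr (_ + (_ + _)).
by rewrite [LHS]addrCA; congr (_ + _); rewrite [RHS]addrC addrA.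
Qed.

Lemma sqr_vnorm_damp c (v : 'cV[R[i]]_(\sum_i m i)) :
  vnorm (damp c v) ^+ 2 = \sum_j c j ^+ 2 * vnorm (submxcol v j) ^+ 2.
Proof.
rewrite sqr_vnorm_mxcol; apply: eq_bigr => j _.
by rewrite vnormZ normc_real exprMn real_normK// num_real.
Qed.

Lemma sqr_vnorm_submxcol (v : 'cV[R[i]]_(\sum_i m i)) :
  vnorm v ^+ 2 = \sum_j vnorm (submxcol v j) ^+ 2.
Proof. by rewrite -{1}[v]submxcolK sqr_vnorm_mxcol. Qed.

Lemma l2_damp P (c : 'I_P -> 'I_N -> R) (s : R) v : 0 <= s ->
  (forall j, \sum_p c p j ^+ 2 = s ^+ 2) ->
  l2 (fun p => vnorm (damp (c p) v)) = s * vnorm v.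
Proof.
move=> s0 cs; apply: l2_eqsqr; first by rewrite mulr_ge0 ?vnorm_ge0.
under [RHS]eq_bigr do rewrite sqr_vnorm_damp.
rewrite exchange_big/= exprMn sqr_vnorm_submxcol mulr_sumr.
by apply: eq_bigr => j _; rewrite -mulr_suml cs.
Qed.

(** [Q] has at most one entry in each row and column, as an off-diagonal does:
    each block row then has a single term, and each block of [v] is counted at
    most once.  Hence it is enough that [r] bounds the norm of single blocks. *)
Lemma l2_coupling P (Q : rel 'I_N) (c : 'I_P -> 'I_N -> R) (r t : R) v :
  0 <= r -> 0 <= t ->
  (forall i j j', Q i j -> Q i j' -> j = j') ->
  (forall i i' j, Q i j -> Q i' j -> i = i') ->
  (forall i j, Q i j -> opnorm (submxblock A i j) <= r) ->
  (forall i j, Q i j -> \sum_p (c p j - c p i) ^+ 2 = t ^+ 2) ->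
  l2 (fun p => vnorm (coupling Q (c p) v)) <= r * t * vnorm v.
Proof.
move=> r0 t0 Qr Ql Ar ct.
rewrite -[leRHS]ger0_norm ?mulr_ge0 ?vnorm_ge0// -sqrtr_sqr.
apply: ler_wsqrtr.
have step p : vnorm (coupling Q (c p) v) ^+ 2 <= \sum_i \sum_(j | Q i j)
    (c p j - c p i) ^+ 2 * (r ^+ 2 * vnorm (submxcol v j) ^+ 2).
  rewrite sqr_vnorm_mxcol; apply: ler_sum => i _.
  have [j Qij|Qi] := pickP (Q i); last by rewrite !big_pred0// vnorm0 expr0n.
  have Qi : Q i =1 pred1 j.
    by move=> j'; apply/idP/eqP => [/Qr/(_ Qij)|->//].
  rewrite !(big_pred1 j)// vnormZ normc_real exprMn real_normK ?num_real//.
  rewrite ler_wpM2l ?sqr_ge0// -exprMn lerXn2r ?nnegrE ?mulr_ge0 ?vnorm_ge0//.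
  by apply: le_trans (opnorm_ge _ _) _; rewrite ler_wpM2r ?vnorm_ge0 ?Ar.
apply: le_trans (ler_sum _ (fun p _ => step p)) _.
rewrite exchange_big/=; under eq_bigr => i _ do rewrite exchange_big/=.
under eq_bigr => i _ do
  under eq_bigr => j Qij do rewrite -mulr_suml (ct _ _ Qij).
rewrite (exchange_big_dep predT)//= !exprMn sqr_vnorm_submxcol mulr_sumr.
apply: ler_sum => j _.
have z0 : 0 <= t ^+ 2 * (r ^+ 2 * vnorm (submxcol v j) ^+ 2).
  by rewrite !mulr_ge0 ?sqr_ge0 ?vnorm_ge0.
rewrite -[leRHS]mulrA [leRHS]mulrCA.
have [i Qij|Qj] := pickP (Q^~ j); last by rewrite big_pred0.
by rewrite (big_pred1 i)// => i'; apply/idP/eqP => [/Ql/(_ Qij)|->//].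
Qed.

Lemma rL_ge0 : 0 <= rL A.
Proof. by rewrite /rL; exact: bigmax_ge_id. Qed.

Lemma rU_ge0 : 0 <= rU A.
Proof. by rewrite /rU; exact: bigmax_ge_id. Qed.

Lemma le_rL i j : below i j -> opnorm (submxblock A i j) <= rL A.
Proof.
by move=> ij; rewrite /rL (bigmaxD1 (i, j))//= le_max lexx.
Qed.

Lemma le_rU i j : above i j -> opnorm (submxblock A i j) <= rU A.
Proof.
by move=> ij; rewrite /rU (bigmaxD1 (i, j))//= le_max lexx.
Qed.

(** The window at position [p] puts positive weight on the blocks
    [p - n, ..., p - 1].  The shift [n.+1] makes every position of every block
    inside the window, [0] and [n.+1] included, occur for a natural number
    [p < N + n.+1]. *)
Definition sine_window n p (j : 'I_N) : R := weight R n (j + n.+1 - p).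

(** Take the Euclidean norm over [p] of the hypothesis and of the decomposition
    [tridiag_damp]: with [s ^+ 2] the sum of the squared weights, the damped
    vectors contribute [s * vnorm v] and [s * vnorm ((tridiag A - l%:M) *m v)],
    and each off-diagonal its largest block norm times
    [2 * sin (pi / (2 * n + 2)%:R) * s]; then divide by [s]. *)
Lemma averaging n (l : R[i]) (mu : R) v : (0 < n)%N -> 0 <= mu ->
  (forall p, mu * vnorm (damp (sine_window n p) v) <=
    vnorm ((tridiag A - l%:M) *m damp (sine_window n p) v)) ->
  mu * vnorm v <= vnorm ((tridiag A - l%:M) *m v) +
    2 * rLU A * sin (pi / (2 * n + 2)%:R) * vnorm v.
Proof.
move=> n0 mu0 muB.
set y := (tridiag A - l%:M) *m v.
pose c (p : 'I_(N + n.+1)) := sine_window n p.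
have S0 := @weight_mass_gt0 R n n0.
pose s := Num.sqrt (weight_mass R n).
have s0 : 0 < s by rewrite sqrtr_gt0.
have sE : s ^+ 2 = weight_mass R n by rewrite sqr_sqrtr// ltW.
pose sg : R := sin (pi / (2 * n + 2)%:R).
have sg0 : 0 <= sg.
  apply: sin_ge0_pi; rewrite divr_ge0 ?pi_ge0//=.
  by rewrite ler_pdivrMr ?ltr0n ?addn2// ler_peMr ?pi_ge0// ler1n.
have massE j : \sum_p c p j ^+ 2 = s ^+ 2.
  by rewrite sE /c /sine_window sum_sqr_weight//; have := ltn_ord j; lia.
have diffE (i j : 'I_N) : below i j \/ above i j ->
    \sum_p (c p j - c p i) ^+ 2 = (2 * sg * s) ^+ 2.
  rewrite exprMn sE /c /sine_window /below /above => -[|] /eqP ij.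
    under eq_bigr => p _ do rewrite ij addSn -sqrrN opprB.
    by rewrite sum_sqr_weight_diff//; have := ltn_ord j; lia.
  under eq_bigr => p _ do rewrite ij addSn.
  by rewrite sum_sqr_weight_diff//; have := ltn_ord i; lia.
have t0 : 0 <= 2 * sg * s by rewrite !mulr_ge0// ltW.
have lowE : l2 (fun p => vnorm (coupling below (c p) v)) <=
    rL A * (2 * sg * s) * vnorm v.
  apply: l2_coupling => //; first exact: rL_ge0.
  - by move=> i j j'; rewrite /below => ? ?; apply: val_inj => /=; lia.
  - by move=> i i' j; rewrite /below => ? ?; apply: val_inj => /=; lia.
  - exact: le_rL.
  - by move=> i j ij; apply: diffE; left.
have uppE : l2 (fun p => vnorm (coupling above (c p) v)) <=
    rU A * (2 * sg * s) * vnorm v.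
  apply: l2_coupling => //; first exact: rU_ge0.
  - by move=> i j j'; rewrite /above => ? ?; apply: val_inj => /=; lia.
  - by move=> i i' j; rewrite /above => ? ?; apply: val_inj => /=; lia.
  - exact: le_rU.
  - by move=> i j ij; apply: diffE; right.
rewrite -(ler_pM2l s0).
have -> : s * (mu * vnorm v) = l2 (fun p => mu * vnorm (damp (c p) v)).
  by rewrite l2_scale// (l2_damp v (ltW s0) massE) mulrCA.
apply: (@le_trans _ _ (l2 (fun p => vnorm (damp (c p) y) +
    (vnorm (coupling below (c p) v) + vnorm (coupling above (c p) v))))).
  apply: l2_le => p; rewrite mulr_ge0 ?vnorm_ge0//=.
  apply: le_trans (muB p) _; rewrite tridiag_damp -/y -addrA.
  by apply: le_trans (vnormD _ _) _; rewrite lerD2l vnormD.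
apply: le_trans (minkowski _ _) _; rewrite (l2_damp y (ltW s0) massE).
rewrite mulrDr lerD2l; apply: le_trans (minkowski _ _) _.
apply: le_trans (lerD lowE uppE) _.
by rewrite -/sg /rLU le_eqVlt; apply/orP; left; apply/eqP; ring.
Qed.

End Averaging.

(** * The two inclusions *)

Section Inclusions.
Variables (R : realType) (N : nat) (m : 'I_N -> nat).
Variables (A : 'M[R[i]]_(\sum_i m i)) (n : nat).
Hypotheses (m0 : forall j, (0 < m j)%N) (n0 : (0 < n)%N) (nN : (n <= N)%N).

Let C := remaining A.

Lemma mulmx_remaining (l : R[i]) (x : 'cV[R[i]]_(\sum_i m i)) :
  (A - l%:M) *m x = (tridiag A - l%:M) *m x + C *m x.
Proof. by rewrite -mulmxDl /C /remaining [in RHS]addrC addrA subrK. Qed.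

Lemma vnorm_tridiag_le (l : R[i]) (x : 'cV[R[i]]_(\sum_i m i)) :
  vnorm ((tridiag A - l%:M) *m x) <=
  vnorm ((A - l%:M) *m x) + opnorm C * vnorm x.
Proof.
have -> : (tridiag A - l%:M) *m x = (A - l%:M) *m x + - (C *m x).
  by rewrite mulmx_remaining addrK.
by apply: le_trans (vnormD _ _) _; rewrite vnormN lerD2l opnorm_ge.
Qed.

Lemma vnorm_tridiag_ge (l : R[i]) (x : 'cV[R[i]]_(\sum_i m i)) :
  vnorm ((A - l%:M) *m x) - opnorm C * vnorm x <=
  vnorm ((tridiag A - l%:M) *m x).
Proof.
rewrite lerBlDr mulmx_remaining; apply: le_trans (vnormD _ _) _.
by rewrite lerD2l opnorm_ge.
Qed.

Lemma dim_gt0 : (0 < \sum_(i < N) m i)%N.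
Proof.
have N0 : (0 < N)%N by apply: leq_trans nN.
by rewrite (bigD1 (Ordinal N0))//= addn_gt0 m0.
Qed.

Lemma Gamma_sub_pspec eps :
  Gamma n eps A `<=` pspec (eps + eps' n A + opnorm C) A.
Proof.
move=> l [k /= kN]; rewrite /rpspec /pspec/= => lk.
rewrite -lerBlDr; apply: le_trans lk; apply: le_smin_window => // [|x].
  by lia.
apply: le_trans (vnorm_tridiag_ge l x).
by rewrite mulrBl lerD2r smin_le.
Qed.

(** Sine windows that stick out of the matrix are moved inside: their support
    within the matrix is contained in the first, or in the last, full window.
    So the full windows suffice for [averaging]. *)
Lemma submxcol_damp_window p : exists k : 'I_(N - n).+1,
  forall (v : 'cV[R[i]]_(\sum_i m i)) (j : 'I_N), ~~ (k <= j < k + n)%N ->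
    submxcol (damp (sine_window R n p) v) j = 0.
Proof.
have kN : (minn (p - n) (N - n) < (N - n).+1)%N by rewrite ltnS geq_minr.
exists (Ordinal kN) => v j /= jk.
rewrite mxcolK /sine_window; set q := (_ - p)%N.
suff -> : weight R n q = 0 by rewrite scale0r.
have [q0|q0] := eqVneq q 0%N; first by rewrite q0 weight0.
apply: weight_out; move: q0 jk; rewrite /q.
by have := ltn_ord j; lia.
Qed.

(** Choosing [k0] before any vector, as a minimizer of the smallest singular
    values of the finitely many windows, yields one window that works for the
    infimum [smin (A - l%:M)] itself, not merely for an approximate
    minimizer. *)
Lemma pspec_sub_Gamma eps : pspec eps A `<=` Gamma n eps A.
Proof.
move=> l; rewrite /pspec/= => lA.
pose s (k : 'I_(N - n).+1) := smin (Bplus A n k - l *: Iplus R m n k).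
have [k0 _ k0min] := @arg_minP _ _ _ ord0 xpredT s isT.
exists (k0 : nat); first by rewrite /= -ltnS.
rewrite /rpspec/= -/(s k0) -lerBlDr; apply: le_trans lA.
apply: le_smin => [|v]; first exact: dim_gt0.
have mu0 : 0 <= s k0 by apply: smin_ge0; exact: sum_bsize_gt0.
have := @averaging _ _ _ A n l (s k0) v n0 mu0.
have windowP p : s k0 * vnorm (damp (sine_window R n p) v) <=
    vnorm ((tridiag A - l%:M) *m damp (sine_window R n p) v).
  have [k kS] := submxcol_damp_window p.
  apply: le_trans (smin_window_le _ _ (kS v)).
  by rewrite ler_wpM2r ?vnorm_ge0// k0min.
move=> /(_ windowP); have := vnorm_tridiag_le l v; rewrite /eps' -/C; lra.
Qed.

End Inclusions.

Theorem theorem1p6 (R : realType) (N : nat) (m : 'I_N -> nat)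
    (A : 'M[R[i]]_(\sum_(i < N) m i))
    (hN : (1 < N)%N) (hM : (N <= \sum_(i < N) m i)%N)
    (hm : forall i : 'I_N, (1 <= m i <= \sum_(j < N) m j - 1)%N)
    (n : nat) (hn : (1 <= n <= N - 1)%N) :
  (forall eps : R, 0 <= eps ->
     pspec eps A `<=` Gamma n eps A /\
     Gamma n eps A `<=`
       pspec (eps + eps' n A + 2 * opnorm (remaining A)) A) /\
  (spec A `<=` Gamma n 0 A /\
   Gamma n 0 A `<=` pspec (eps' n A + 2 * opnorm (remaining A)) A).
Proof.
have m0 j : (0 < m j)%N by have /andP[] := hm j.
have [n0 nN] : (0 < n)%N /\ (n <= N)%N by split; lia.
have upper eps : Gamma n eps A `<=`
    pspec (eps + eps' n A + 2 * opnorm (remaining A)) A.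
  move=> l /(Gamma_sub_pspec m0 n0 nN); rewrite /pspec/= => /le_trans; apply.
  by have := opnorm_ge0 (remaining A); lra.
split=> [eps _|]; first by split=> //; exact: pspec_sub_Gamma.
split; last by have := @upper 0; rewrite add0r.
by move=> l lA; apply: pspec_sub_Gamma => //; exact: eigenvalue_smin.
Qed.
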